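(* Let $A$ be a closed linear operator on a complex Banach space $\mathbb X$ such that (a) $\sigma(A)\subset i\mathbb R$, and (b) there is a positive number $M$, independent of $\lambda$, with $$\|R(\lambda,A)\|\le\frac{M}{|\mathrm{Re}\,\lambda|}\quad\text{for all }\lambda\in\mathbb C\text{ with }\mathrm{Re}\,\lambda\ne0.$$ Then the following assertions hold: (i) If $\lambda_0=i\xi\in i\mathbb R$ is an isolated point of $\sigma(A)$, then it is an eigenvalue of $A$. (ii) If $\mathbb X$ is non-trivial, then $\sigma(A)\neq\emptyset$. (iii) If $\sigma(A)=\{0\}$, then $A=0$.
   Context: $A$ is a (possibly unbounded) closed linear operator with domain $D(A)\subset\mathbb X$; $D(A)$ is not assumed dense. $R(\lambda,A)=(\lambda-A)^{-1}$ denotes the resolvent for $\lambda$ in the resolvent set $\rho(A)=\mathbb C\setminus\sigma(A)$. $A=0$ means that $A$ is the zero operator defined on all of $\mathbb X$. *)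

(* Defs.v *)
From HB Require Import structures.
From mathcomp Require Import all_boot all_order all_algebra.
From mathcomp Require Import complex.
From mathcomp Require Import all_classical all_reals all_analysis.
Import Order.TTheory GRing.Theory Num.Theory numFieldNormedType.Exports.
Set Implicit Arguments.
Unset Strict Implicit.
Unset Printing Implicit Defensive.
Local Open Scope classical_set_scope.
Local Open Scope ring_scope.
Local Open Scope complex_scope.

(** The linear operator [x |-> lop_fun x] with domain [lop_dom], a linear
    subspace of [X]. Values of [lop_fun] outside [lop_dom] are meaningless and
    are never used below. *)
Record linear_op (K : numFieldType) (X : lmodType K) := LinearOp {
  lop_dom : set X ;
  lop_fun :> X -> X ;
  lop_dom0 : lop_dom 0 ;
  lop_domP : forall (a : K) (x y : X),
    lop_dom x -> lop_dom y -> lop_dom (a *: x + y) ;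
  lop_linear : forall (a : K) (x y : X),
    lop_dom x -> lop_dom y ->
    lop_fun (a *: x + y) = a *: lop_fun x + lop_fun y }.

Section Spectrum.
Variables (R : realType) (X : normedModType R[i]).
Implicit Types (A : linear_op X) (l : R[i]).

Definition closed_op A : Prop :=
  closed [set z : X * X | lop_dom A z.1 /\ z.2 = A z.1].

(** MathComp-Analysis norms on an [R[i]]-normed module take values in [R[i]]
    (with zero imaginary part), hence the [complex.Re]. The value is [+oo]
    when [T] is unbounded. *)
Definition op_norm (T : X -> X) : \bar R :=
  ereal_sup [set (complex.Re `|T x|)%:E | x in [set x : X | `|x| <= 1]].

Definition shift_op A l : X -> X := fun x => l *: x - A x.

(** The inverse of [l - A : D(A) -> X], when it exists. *)
Definition resolvent A l : X -> X :=
  fun y => xget 0 [set x | lop_dom A x /\ shift_op A l x = y].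

Definition resolvent_set A : set R[i] :=
  [set l | set_bij (lop_dom A) setT (shift_op A l) /\
           (op_norm (resolvent A l) < +oo)%E].

(** [R[i]] itself has no topology in the library; its regular module [R[i]^o]
    carries the one induced by the modulus. *)
Definition spectrum A : set R[i]^o := ~` resolvent_set A.

Definition eigenvalue_op A l : Prop :=
  exists x : X, [/\ lop_dom A x, x != 0 & A x = l *: x].

Definition is_zero_op A : Prop :=
  lop_dom A = setT /\ forall x : X, A x = 0.

End Spectrum.

(* Main.v *)
(** The resolvent is controlled by a maximum principle instead of contour
    integrals. On the circle [|z| = r] one has [|z^2 + r^2| = 2 r |Re z|], so
    [(z^2 + r^2)(z^2 + s^2) R(z) / z] is bounded by [2 M (r^2 + s^2)] on both
    boundary circles of the annulus [r <= |z| <= s], hence inside: near an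
    isolated point [c] of the spectrum [|z R(c + z)|] is bounded by [4 M]. Then
    [R(c + z) (A - c) = z R(c + z) - 1] is bounded near [z = 0], and the maximum
    principle corrected by a small multiple of [ln |z|] bounds it on the range
    of [A - c] by the constant [8 M / s] coming from the outer circle only. This
    makes [z R(c + z)] Lipschitz near [0]; its limit takes values in the kernel
    of [A - c], and if that limit vanishes then [R(c + z)] stays bounded and [c]
    is not in the spectrum. If the spectrum lies in [{0}], letting [s] tend to
    infinity gives [A = 0]; for an empty spectrum [0 - A] is moreover injective,
    so that the space is trivial. *)
Require Import Defs.
From mathcomp Require Import all_boot all_order all_algebra.
From mathcomp Require Import complex.
From mathcomp Require Import all_classical all_reals all_analysis.
From mathcomp Require Import ring lra.
Import Order.TTheory GRing.Theory Num.Theory numFieldNormedType.Exports.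
Local Open Scope classical_set_scope.
Local Open Scope ring_scope.
Local Open Scope complex_scope.

(** * Real-valued norms on complex spaces *)

(** Moves norms from [R[i]], whose order is partial, into [R], where real order lemmas and [lra]
    apply. *)
Definition nrm {R : realType} {V : normedZmodType R[i]} (x : V) : R :=
  complex.Re `|x|.

Section RealNorm.
Context {R : realType} {V : normedZmodType R[i]}.
Implicit Types x y : V.

Lemma nrmE x : `|x| = (nrm x)%:C.
Proof. by rewrite /nrm RRe_real// normr_real. Qed.

Lemma nrm_ge0 x : 0 <= nrm x.
Proof. by rewrite -ler0c -nrmE. Qed.

Lemma nrm0 : nrm (0 : V) = 0.
Proof. by rewrite /nrm normr0. Qed.

Lemma nrmN x : nrm (- x) = nrm x.
Proof. by rewrite /nrm normrN. Qed.

Lemma nrmBC x y : nrm (x - y) = nrm (y - x).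
Proof. by rewrite /nrm distrC. Qed.

Lemma nrm_eq0 x : (nrm x == 0) = (x == 0).
Proof. by rewrite -(normr_eq0 x) nrmE -(inj_eq (@complexI R)). Qed.

Lemma nrm_gt0 x : (0 < nrm x) = (x != 0).
Proof. by rewrite lt_def nrm_eq0 nrm_ge0 andbT. Qed.

Lemma nrmD x y : nrm (x + y) <= nrm x + nrm y.
Proof.
rewrite -lecR -nrmE; apply: (le_trans (ler_normD x y)).
by rewrite !nrmE -rmorphD.
Qed.

Lemma nrmB x y : nrm (x - y) <= nrm x + nrm y.
Proof. by rewrite -(nrmN y) nrmD. Qed.

Lemma nrm_dist x y : `|nrm x - nrm y| <= nrm (x - y).
Proof.
have h a b : nrm a - nrm b <= nrm (a - b :> V).
  by rewrite lerBlDr; apply: le_trans (nrmD _ _); rewrite subrK.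
by rewrite ler_norml h lerNl opprB nrmBC h.
Qed.

Lemma nrm_sum (I : finType) (F : I -> V) :
  nrm (\sum_i F i) <= \sum_i nrm (F i).
Proof.
elim/big_ind2: _ => [||//]; first by rewrite nrm0.
by move=> a b c d h h'; apply: le_trans (nrmD _ _) _; apply: lerD.
Qed.

End RealNorm.

Section ComplexNorm.
Context {R : realType}.
Implicit Types (z w : R[i]) (r : R).

Lemma nrmM z w : nrm (z * w) = nrm z * nrm w.
Proof. by apply: complexI; rewrite rmorphM -!nrmE normrM. Qed.

Lemma nrmX z n : nrm (z ^+ n) = nrm z ^+ n.
Proof. by apply: complexI; rewrite rmorphXn -!nrmE normrX. Qed.

Lemma nrmV z : nrm z^-1 = (nrm z)^-1.
Proof. by apply: complexI; rewrite fmorphV -!nrmE normfV. Qed.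

Lemma nrm_real r : nrm (r%:C) = `|r|.
Proof. by rewrite /nrm normc_def /= expr0n /= addr0 sqrtr_sqr. Qed.

Lemma nrm2 z : nrm z ^+ 2 = complex.Re z ^+ 2 + complex.Im z ^+ 2.
Proof. by rewrite /nrm normc_def /= sqr_sqrtr// addr_ge0 ?sqr_ge0. Qed.

Lemma nrm_i : nrm ('i : R[i]) = 1.
Proof. by rewrite /nrm normc_def /= expr0n /= add0r expr1n sqrtr1. Qed.

Lemma Re_le_nrm z : `|complex.Re z| <= nrm z.
Proof. by rewrite -lecR -nrmE normc_ge_Re. Qed.

Lemma Im_le_nrm z : `|complex.Im z| <= nrm z.
Proof.
rewrite -ler_sqr ?nnegrE ?nrm_ge0// nrm2 real_normK ?num_real//.
by rewrite lerDr sqr_ge0.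
Qed.

(* On the circle [nrm z = s] one has [s^2 = z * conj z]. *)
Lemma nrm_sqrD_circle z r : nrm z = r ->
  nrm (z ^+ 2 + (r ^+ 2)%:C) = 2 * r * `|complex.Re z|.
Proof.
move=> <-.
have -> : z ^+ 2 + (nrm z ^+ 2)%:C = z * (2 * complex.Re z)%:C.
  by rewrite nrm2 add_Re2_Im2 sqr_normc expr2 -mulrDr addcJ rmorphM rmorph_nat.
by rewrite nrmM nrm_real normrM ger0_norm// mulrCA mulrA.
Qed.

Lemma nrm_sqrD_le z r : nrm (z ^+ 2 + (r ^+ 2)%:C) <= nrm z ^+ 2 + r ^+ 2.
Proof.
by apply: le_trans (nrmD _ _) _; rewrite nrmX nrm_real ger0_norm ?sqr_ge0.
Qed.

Lemma nrm_sqrD_ge z r : `|nrm z ^+ 2 - r ^+ 2| <= nrm (z ^+ 2 + (r ^+ 2)%:C).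
Proof.
have := nrm_dist (z ^+ 2) (- (r ^+ 2)%:C).
by rewrite nrmN opprK nrmX nrm_real (ger0_norm (sqr_ge0 r)).
Qed.

End ComplexNorm.

Lemma nrmZ {R : realType} {V : normedModType R[i]} (a : R[i]) (x : V) :
  nrm (a *: x) = nrm a * nrm x.
Proof. by apply: complexI; rewrite -nrmE normrZ !nrmE -rmorphM. Qed.

Lemma near_nrmP {R : realType} (V : normedModType R[i]) (z : V)
    (P : V -> Prop) :
  (\forall w \near z, P w) <->
  exists2 d : R, 0 < d & forall w, nrm (w - z) < d -> P w.
Proof.
split=> [/nbhs_normP[e /= e0 h]|[d d0 h]].
  exists (complex.Re e).
    by move: e0; rewrite ltcE => /andP[].
  move=> w hw; apply: h; rewrite /= distrC nrmE ltcE hw andbT.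
  by move: e0; rewrite ltcE => /andP[].
apply/nbhs_normP; exists d%:C => /=; first by rewrite ltcR.
by move=> w; rewrite /= distrC nrmE ltcR; exact: h.
Qed.

Lemma cvg_nrmP {R : realType} (T : Type) (F : set_system T) {FF : Filter F}
    (V : normedModType R[i]) (f : T -> V) (l : V) :
  (forall e : R, 0 < e -> \forall t \near F, nrm (f t - l) <= e) ->
  f t @[t --> F] --> l.
Proof.
move=> h; apply/cvgrPdist_le => e e0.
have [e1 e2] : (0 < complex.Re e) /\ e = (complex.Re e)%:C.
  by move: e0; rewrite ltcE; case: (e) => a b /= /andP[/eqP -> ->].
apply: filterS (h _ e1) => t; rewrite distrC nrmE e2 lecR.
by [].
Qed.

Lemma nrm_continuous {R : realType} (V : normedModType R[i]) :
  continuous (nrm : V -> R).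
Proof.
move=> z; apply/cvgrPdist_lt => e e0; apply/near_nrmP; exists e => // w hw.
by rewrite distrC; apply: le_lt_trans (nrm_dist _ _) hw.
Qed.

(** * Iterated divisibility of increments *)

Section Smooth.
Context {R : realType} {V : normedModType R[i]}.
Implicit Types (f g : R[i]^o -> V) (p q : R[i]^o -> R[i]^o) (z w : R[i]^o).

Definition locally_bounded {U : normedModType R[i]} (f : R[i]^o -> U) z :=
  exists C : R, \forall w \near z, nrm (f w) <= C.

(* [n]-fold divisibility of increments by [w - z]: a form of [n]-fold complex
   differentiability at [z] that is evidently stable under products. *)
Fixpoint smooth {U : normedModType R[i]} n (f : R[i]^o -> U) z : Prop :=
  if n is m.+1 then exists2 g, smooth m g z &
    \forall w \near z, f w = f z + (w - z) *: g w
  else locally_bounded f z.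

Lemma smooth_cst {U : normedModType R[i]} n (c : U) z : smooth n (fun=> c) z.
Proof.
elim: n c => [c|n IH c].
  by exists (nrm c); apply: (@filterE _ (nbhs z)) => w.
exists (fun=> 0); first exact: IH.
by apply: (@filterE _ (nbhs z)) => w; rewrite scaler0 addr0.
Qed.

Lemma smoothD {U : normedModType R[i]} n (f g : R[i]^o -> U) z :
  smooth n f z -> smooth n g z -> smooth n (fun w => f w + g w) z.
Proof.
elim: n f g => [f g [C hC] [D hD]|n IH f g [f' hf' ef] [g' hg' eg]].
  exists (C + D); apply: filterS2 hC hD => w h1 h2.
  by apply: le_trans (nrmD _ _) _; apply: lerD.
exists (fun w => f' w + g' w); first exact: IH.
by apply: filterS2 ef eg => w -> ->; rewrite scalerDr addrACA.
Qed.

Lemma near_nrmB_lt (z : R[i]^o) (e : R) : 0 < e ->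
  \forall w \near z, nrm (w - z) < e.
Proof. by move=> e0; apply/near_nrmP; exists e. Qed.

Lemma smoothS {U : normedModType R[i]} n (f : R[i]^o -> U) z :
  smooth n.+1 f z -> smooth n f z.
Proof.
elim: n f => [f [g [C hC] ef]|n IH f [g hg ef]]; last first.
  by exists g => //; apply: IH.
exists (nrm (f z) + C); apply: filterS3 ef hC (near_nrmB_lt z 1 ltr01).
move=> w -> h1 h2; apply: le_trans (nrmD _ _) _; rewrite lerD2l nrmZ.
by apply: le_trans h1; rewrite ler_piMl ?nrm_ge0// ltW.
Qed.

Lemma smoothZ n p f z :
  smooth n p z -> smooth n f z -> smooth n (fun w => p w *: f w) z.
Proof.
elim: n p f => [p f [C hC] [D hD]|n IH p f hp hf].
  exists (C * D); apply: filterS2 hC hD => w h1 h2.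
  by rewrite nrmZ; apply: ler_pM => //; apply: nrm_ge0.
have hp1 := smoothS _ _ _ hp.
case: hp => q hq ep; case: hf => g hg eg.
(* Discrete product rule: p f - p(z) f(z) = p (f - f(z)) + (p - p(z)) f(z). The factor [p] survives
   in the quotient, hence the use of [hp1]. *)
exists (fun w => p w *: g w + q w *: f z).
  by apply: smoothD; apply: IH => //; exact: smooth_cst.
apply: filterS2 ep eg => w ep eg.
have e1 : (w - z) *: (p w *: g w) = p w *: (f w - f z).
  by rewrite scalerA mulrC -scalerA eg [X in _ = _ *: X]addrC addKr.
have e2 : (w - z) *: (q w *: f z) = (p w - p z) *: f z.
  by rewrite scalerA; congr (_ *: _); rewrite ep [RHS]addrC addKr.
rewrite scalerDr e1 e2 scalerBr scalerBl [X in _ + X]addrA subrK.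
by rewrite [RHS]addrC subrK.
Qed.

Lemma smooth_id n z : smooth n (fun w => w : R[i]^o) z.
Proof.
case: n => [|n]; last first.
  exists (fun=> 1); first exact: smooth_cst.
  apply: (@filterE _ (nbhs z)) => w.
  by rewrite -[_ *: 1]/(_ * 1) mulr1 addrC subrK.
exists (nrm z + 1); apply: filterS (near_nrmB_lt z 1 ltr01) => w hw.
by rewrite -[w in nrm w](subrK z) addrC (le_trans (nrmD _ _))// lerD2l ltW.
Qed.

Lemma smooth_expand f z : smooth 3 f z ->
  exists a b, exists2 g, locally_bounded g z & \forall w \near z,
    f w = f z + ((w - z) *: a + ((w - z) ^+ 2 *: b + (w - z) ^+ 3 *: g w)).
Proof.
move=> [g [h [k hk ek] eh] eg]; exists (g z), (h z), k => //.
apply: filterS3 ek eh eg => w -> -> ->.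
by rewrite !exprS expr0 mulr1 -!scalerA !scalerDr.
Qed.

Lemma smooth_continuous f z : smooth 1 f z -> {for z, continuous f}.
Proof.
move=> [g [C hC] ef]; apply: (@cvg_nrmP _ _ (nbhs z)) => e e0.
have C1 : 0 < `|C| + 1 by rewrite ltr_wpDl.
apply: filterS3 ef hC (near_nrmB_lt z (e / (`|C| + 1)) (divr_gt0 e0 C1)).
move=> w -> h1 h2; rewrite addrC addKr nrmZ.
apply: (@le_trans _ _ (e / (`|C| + 1) * (`|C| + 1))); last first.
  by rewrite divfK// gt_eqF.
apply: ler_pM; rewrite ?nrm_ge0 ?(ltW h2)//.
by apply: le_trans h1 _; apply: le_trans (ler_norm _) _; rewrite lerDl.
Qed.

End Smooth.

(** * Approximate mean inequalities on small squares *)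

Section Submean.
Context {R : realType}.
Implicit Types (v : R[i]^o -> R) (z w : R[i]^o) (rho : R).

(* Subharmonicity up to third order, tested on the vertices of a square. *)
Definition submean v z := exists C d : R, 0 < d /\ forall rho, 0 < rho < d ->
  4 * v z <= \sum_(k < 4) v (z + 'i ^+ k * rho%:C) + C * rho ^+ 3.

Lemma nrm_ik (k : nat) rho : 0 <= rho -> nrm ('i ^+ k * rho%:C : R[i]) = rho.
Proof.
by move=> h; rewrite nrmM nrmX nrm_i expr1n mul1r nrm_real ger0_norm.
Qed.

Lemma sum_ik rho : \sum_(k < 4) ('i ^+ k * rho%:C : R[i]) = 0.
Proof.
rewrite -mulr_suml !big_ord_recr big_ord0 /= !exprS expr0 !mulr1 -expr2 sqr_i.
by rewrite mulrN1; ring.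
Qed.

Lemma sum_ik2 rho : \sum_(k < 4) ('i ^+ k * rho%:C : R[i]) ^+ 2 = 0.
Proof.
under eq_bigr do rewrite exprMn exprAC sqr_i.
rewrite -mulr_suml !big_ord_recr big_ord0 /= !exprS expr0.
by rewrite !mulr1 !mulrN1 opprK; ring.
Qed.

(** The linear and quadratic terms of the expansion cancel over the four vertices by [sum_ik] and
    [sum_ik2]. So 4 f(z) is the sum of the vertex values minus cubic remainders, and the triangle
    inequality concludes. *)
Lemma smooth_submean {V : normedModType R[i]} (f : R[i]^o -> V) z :
  smooth 3 f z -> submean (fun w => nrm (f w)) z.
Proof.
move=> /smooth_expand[a [b [g [C hC] ef]]].
have [d d0 hd] := (near_nrmP _ z _).1 (filterI hC ef).
exists (4 * C), d; split=> // rho /andP[r0 rd].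
pose h (k : 'I_4) : R[i] := 'i ^+ k * rho%:C.
have hE k : nrm (h k) = rho by rewrite nrm_ik// ltW.
have {}hd k : nrm (g (z + h k)) <= C /\ f (z + h k) =
    f z + (h k *: a + (h k ^+ 2 *: b + h k ^+ 3 *: g (z + h k))).
  have e : z + h k - z = h k by rewrite addrC addKr.
  by have := hd (z + h k); rewrite e hE => /(_ rd)[/= ? ->]; rewrite e.
have -> : 4 * nrm (f z) = nrm (4 *: f z).
  by rewrite nrmZ -(rmorph_nat (real_complex R)) nrm_real ger0_norm.
have -> : 4 *: f z = \sum_(k < 4) (f (z + h k) - h k ^+ 3 *: g (z + h k)).
  transitivity (\sum_(k < 4) (f z + (h k *: a + h k ^+ 2 *: b))).
    move: (sum_ik rho : \sum_k h k = 0) (sum_ik2 rho : \sum_k h k ^+ 2 = 0).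
    move: (h) => u s1 s2.
    rewrite big_split /= sumr_const card_ord big_split /= -!scaler_suml.
    by rewrite s1 s2 !scale0r !addr0 scaler_nat.
  by apply: eq_bigr => k _; rewrite (hd k).2 !addrA addrK.
apply: le_trans (nrm_sum _ _) _.
apply: (@le_trans _ _ (\sum_(k < 4) (nrm (f (z + h k)) + C * rho ^+ 3))).
  apply: ler_sum => k _; apply: le_trans (nrmB _ _) _; rewrite lerD2l nrmZ.
  by rewrite nrmX hE mulrC ler_wpM2r ?exprn_ge0 ?(ltW r0)// (hd k).1.
by rewrite big_split /= sumr_const card_ord -mulrnAl mulr_natl.
Qed.

Lemma submeanD v v' z : submean v z -> submean v' z ->
  submean (fun w => v w + v' w) z.
Proof.
move=> [C [d [d0 h]]] [C' [d' [d'0 h']]].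
exists (C + C'), (Num.min d d'); rewrite lt_min d0; split=> // rho.
rewrite lt_min => /and3P[r0 rd rd'].
have := h rho; have := h' rho; rewrite r0 rd rd' => /(_ erefl) H' /(_ erefl) H.
by rewrite big_split /=; lra.
Qed.

(** The four vertices z + i^k rho multiply to z^4 - rho^4, so the sum of logarithms is ln |z^4 -
    rho^4|, which falls short of 4 ln |z| by O(rho^4) at most. *)
Lemma submean_ln (c : R) z : 0 <= c -> z != 0 ->
  submean (fun w => c * ln (nrm w)) z.
Proof.
move=> c0 z0; have n0 : 0 < nrm z by rewrite nrm_gt0.
pose m := Num.min 1 (nrm z / 2).
(* The bound |z| / 2 keeps the vertices away from 0 and gives D >= n^4 / 2 below; the bound 1 gives
   rho^4 <= rho^3. *)
have m0 : 0 < m by rewrite lt_min ltr01 divr_gt0.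
exists (c * (2 / nrm z ^+ 4)), m; split=> // rho /andP[r0].
rewrite lt_min => /andP[r1 r2].
have zk (k : nat) : 0 < nrm (z + 'i ^+ k * rho%:C).
  have h : nrm z <= nrm (z + 'i ^+ k * rho%:C) + rho.
    rewrite -[X in _ + X](nrm_ik k rho (ltW r0)).
    have := nrmB (z + 'i ^+ k * rho%:C) ('i ^+ k * rho%:C).
    by rewrite addrK.
  lra.
rewrite -mulr_sumr.
have -> : \sum_(k < 4) ln (nrm (z + 'i ^+ k * rho%:C)) =
    ln (nrm (z ^+ 4 - (rho ^+ 4)%:C)).
  have -> : z ^+ 4 - (rho ^+ 4)%:C = \prod_(k < 4) (z + 'i ^+ k * rho%:C).
    rewrite !big_ord_recr big_ord0 /= !exprS expr0 !mulr1 mul1r.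
    rewrite rmorphM rmorphM rmorphM /=.
    have i2 := sqr_i R; rewrite expr2 in i2; rewrite i2.
    rewrite !mulrN1 /=.
    transitivity ((z * z - rho%:C * rho%:C) *
                  (z * z - ('i * 'i) * (rho%:C * rho%:C))).
      by rewrite i2; ring.
    by ring.
  rewrite !big_ord_recr !big_ord0 /= mul1r add0r !nrmM.
  by rewrite !lnM ?posrE ?mulr_gt0.
set n := nrm z in n0 r2 *.
have rn : rho ^+ 4 <= n ^+ 4 / 2.
  have : rho ^+ 4 <= (n / 2) ^+ 4.
    by rewrite lerXn2r ?nnegrE ?divr_ge0 ?ltW.
  by have := exprn_gt0 4 n0; rewrite expr_div_n; lra.
have n4 := exprn_gt0 4 n0.
pose D := n ^+ 4 - rho ^+ 4.
have D0 : 0 < D by rewrite /D; lra.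
have DE : n ^+ 4 = D * (1 + rho ^+ 4 / D) by rewrite /D; field; lra.
have q0 : 0 <= rho ^+ 4 / D by rewrite divr_ge0// ?exprn_ge0 ?ltW.
(* This is ln (1 + t) <= t at t = rho^4 / D. *)
have h1 : 4 * ln n <= ln D + rho ^+ 4 / D.
  rewrite mulr_natl -lnXn// DE lnM ?posrE//; last lra.
  by rewrite lerD2l le_ln1Dx//; lra.
have h2 : ln D <= ln (nrm (z ^+ 4 - (rho ^+ 4)%:C)).
  have h : D <= nrm (z ^+ 4 - (rho ^+ 4)%:C).
    have := nrm_dist (z ^+ 4) (rho ^+ 4)%:C.
    rewrite nrmX nrm_real (ger0_norm (exprn_ge0 4 (ltW r0))).
    by apply: le_trans; exact: ler_norm.
  by rewrite ler_ln ?posrE// (lt_le_trans D0).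
have h3 : rho ^+ 4 / D <= 2 / n ^+ 4 * rho ^+ 3.
  rewrite ler_pdivrMr//.
  have -> : 2 / n ^+ 4 * rho ^+ 3 * D = 2 * (rho ^+ 3 * D) / n ^+ 4 by ring.
  rewrite ler_pdivlMr//.
  have r4 : rho ^+ 4 <= rho ^+ 3 by rewrite ler_wiXn2l ?ltW.
  have r3 := exprn_gt0 3 r0.
  have -> : 2 * (rho ^+ 3 * D) = rho ^+ 3 * (2 * D) by ring.
  by apply: ler_pM => //; rewrite ?exprn_ge0 ?(ltW r0)//; rewrite /D; lra.
have := ler_wpM2l c0 (le_trans h1 (lerD h2 h3)).
by rewrite mulrDr mulrCA [X in _ <= _ + X]mulrA.
Qed.

End Submean.

(** * The maximum principle on a closed annulus *)

Section MaximumPrinciple.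
Context {R : realType}.
Implicit Types (v : R[i]^o -> R) (z w : R[i]^o).

(** Transports the annulus to [R * R], where it is a closed part of a compact box. *)
Let cplx (p : R * R) : R[i]^o := p.1 +i* p.2.

Let cplx_continuous : continuous cplx.
Proof.
move=> p; apply: (@cvg_nrmP _ _ (nbhs p)) => e e0.
have e2 : 0 < e / 2 by rewrite divr_gt0.
have h : \forall q \near p, ball p.1 (e / 2) q.1 /\ ball p.2 (e / 2) q.2.
  exists (ball p.1 (e / 2), ball p.2 (e / 2)) => //.
  by split; exact: nbhsx_ballx.
apply: filterS h => q [h1 h2].
have -> : cplx q - cplx p = (q.1 - p.1)%:C + 'i%C * (q.2 - p.2)%:C.
  by rewrite [LHS]complexE.
apply: le_trans (nrmD _ _) _; rewrite nrmM nrm_i mul1r !nrm_real.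
by rewrite (distrC q.1) (distrC q.2); move: h1 h2; rewrite /ball /=; lra.
Qed.

Lemma annulus_compact_max v (r s : R) z0 :
  (forall z, r <= nrm z <= s -> {for z, continuous v}) -> r <= nrm z0 <= s ->
  exists2 z, r <= nrm z <= s & forall w, r <= nrm w <= s -> v w <= v z.
Proof.
move=> cv hz0.
pose K := [set p : R * R | r <= nrm (cplx p) <= s].
have cK : compact K.
  have -> : K = (`[- s, s] `*` `[- s, s]) `&` ((nrm \o cplx) @^-1` `[r, s]).
    apply/seteqP; split => [p /= hp|p /= [_]]; last by rewrite in_itv.
    rewrite /= !in_itv /= hp; case/andP: hp => _ hs; split=> //; split => /=.
      by rewrite -ler_norml; exact: le_trans (Re_le_nrm (cplx p)) hs.
    by rewrite -ler_norml; exact: le_trans (Im_le_nrm (cplx p)) hs.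
  apply: compact_closedI.
    by apply: compact_setX; exact: segment_compact.
  apply: preimage_closed; last exact: itv_closed.
  move=> p _; apply: continuous_comp; first exact: cplx_continuous.
  exact: nrm_continuous.
have cK' : {within K, continuous (v \o cplx)}.
  apply: continuous_in_subspaceT => p; rewrite inE => hp.
  by apply: continuous_comp; [exact: cplx_continuous|exact: cv].
have K0 : K !=set0.
  by exists (complex.Re z0, complex.Im z0); rewrite /K /cplx /=; case: z0 hz0.
have [p] := compact_EVT_max K0 cK cK'.
rewrite inE => hp hmax; exists (cplx p) => // w hw.
have := hmax (complex.Re w, complex.Im w).
by rewrite inE /K /cplx /=; case: w hw => a b /= hw; exact.
Qed.

(** Strict subharmonicity of |z|^2: its mean over the square exceeds its value at the centre by
    exactly rho^2. *)
Lemma nrm2_square z (rho : R) :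
  \sum_(k < 4) nrm (z + 'i ^+ k * rho%:C) ^+ 2 = 4 * nrm z ^+ 2 + 4 * rho ^+ 2.
Proof.
have n2 (w : R[i]^o) : nrm w ^+ 2 = complex.Re w ^+ 2 + complex.Im w ^+ 2.
  exact: nrm2.
under eq_bigr do rewrite n2.
rewrite n2 !big_ord_recr big_ord0 /= !exprS expr0 !mulr1.
have -> : ('i : R[i]) * 'i = -1 by rewrite -expr2 sqr_i.
case: z => x y; rewrite -!complexiE /=.
simpc => /=.
ring.
Qed.

(** Adding c |z|^2 makes the mean inequality strict: the gain 4 c rho^2 beats the error C rho^3 for
    small rho, so the perturbed function has no maximum at an interior point where [v] exceeds
    [B]. *)
Lemma annulus_max v (r s B : R) :
  (forall z, r <= nrm z <= s -> {for z, continuous v}) ->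
  (forall z, r < nrm z < s -> submean v z) ->
  (forall z, nrm z = r \/ nrm z = s -> v z <= B) ->
  forall z, r <= nrm z <= s -> v z <= B.
Proof.
move=> cv sv bv z hz.
apply/ler_addgt0Pr => e e0.
have s2 : 0 < s ^+ 2 + 1 by rewrite ltr_wpDl ?sqr_ge0.
(* With this choice c |m|^2 <= e on the annulus, so the perturbation costs at most e. *)
pose c := e / (s ^+ 2 + 1).
have c0 : 0 < c by rewrite divr_gt0.
pose w z := v z + c * nrm z ^+ 2.
have cw z' : r <= nrm z' <= s -> {for z', continuous w}.
  move=> h; apply: continuousD; first exact: cv.
  apply: continuousM; first exact: cst_continuous.
  apply: (@continuous_comp _ _ _ nrm (fun x : R => x ^+ 2)).
    exact: nrm_continuous.
  exact: exprn_continuous.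
have [m hm mmax] := annulus_compact_max w r s z cw hz.
have bm : v m <= B.
  apply: contrapT => /negP; rewrite -ltNge => Bm.
  have hm' : r < nrm m < s.
    case/andP: hm => h1 h2; rewrite !lt_neqAle h1 h2 !andbT.
    apply/andP; split; apply/eqP => h; move: Bm; rewrite ltNge bv//.
      by left.
    by right.
  have [C [d [d0 hC]]] := sv m hm'.
  pose t := Num.min (nrm m - r) (s - nrm m).
  have t0 : 0 < t by rewrite lt_min !subr_gt0.
  (* For rho <= u the error C rho^3 is at most 2 c rho^2, half of the gain; rho <= t keeps the
     square inside the annulus. *)
  pose u := 2 * c / (`|C| + 1).
  have C1 : 0 < `|C| + 1 by rewrite ltr_wpDl.
  have u0 : 0 < u by rewrite divr_gt0// mulr_gt0.
  pose rho := Num.min (d / 2) (Num.min t u).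
  have rho0 : 0 < rho by rewrite lt_min divr_gt0 //= lt_min t0 u0.
  have rhod : rho < d by rewrite gt_min ltr_pdivrMr// ltr_pMr// ltr1n.
  have rhot : rho <= t by rewrite ge_min [X in _ || X]ge_min lexx /= orbT.
  have rhou : rho <= u by rewrite ge_min [X in _ || X]ge_min lexx !orbT.
  have := hC rho; rewrite rho0 rhod => /(_ erefl).
  apply/negP; rewrite -ltNge.
  have hw (k : 'I_4) : w (m + 'i ^+ k * rho%:C) <= w m.
    have hk : nrm ('i ^+ k * rho%:C : R[i]^o) = rho by exact: nrm_ik (ltW rho0).
    have h1 := nrmD m ('i ^+ k * rho%:C : R[i]^o).
    have h2 := nrmB (m + 'i ^+ k * rho%:C) ('i ^+ k * rho%:C : R[i]^o).
    rewrite addrK in h2; rewrite hk in h1 h2.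
    move: rhot; rewrite le_min => /andP[t1 t2].
    by apply: mmax; apply/andP; split; lra.
  have : \sum_(k < 4) w (m + 'i ^+ k * rho%:C) <= \sum_(k < 4) w m.
    by apply: ler_sum => k _; exact: hw.
  rewrite sumr_const card_ord /w big_split /= -mulr_sumr nrm2_square.
  rewrite -mulr_natl => hsum.
  have Crho : C * rho ^+ 3 <= 2 * c * rho ^+ 2.
    rewrite exprS mulrA ler_wpM2r ?sqr_ge0//.
    apply: (@le_trans _ _ ((`|C| + 1) * u)); last by rewrite mulrC divfK ?gt_eqF.
    apply: le_trans (ler_wpM2r (ltW rho0) (ler_norm C)) _.
    by apply: ler_pM => //; [exact: ltW|rewrite lerDl].
  have : 0 < c * rho ^+ 2 by rewrite mulr_gt0 ?exprn_gt0.
  by lra.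
apply: (@le_trans _ _ (w z)); first by rewrite lerDl mulr_ge0 ?sqr_ge0 ?ltW.
apply: (le_trans (mmax z hz)); rewrite /w lerD//.
have -> : e = c * (s ^+ 2 + 1) by rewrite divfK ?gt_eqF.
apply: ler_wpM2l; first exact: ltW.
case/andP: hm => _ hm; have := nrm_ge0 m => m0.
apply: (@le_trans _ _ (s ^+ 2)); last by rewrite lerDl.
by rewrite lerXn2r ?nnegrE// (le_trans m0).
Qed.
End MaximumPrinciple.

(** * Families satisfying the resolvent identity *)

(** Covers two cases at once: the translated resolvents R(c + z) of an operator, and the scalar
    family z^-1. *)
Definition pseudo_resolvent {R : realType} {V : normedModType R[i]}
    (D : set R[i]^o) (S : R[i]^o -> V -> V) : Prop :=
  (forall z w x, D z -> D w -> S w x = S z x - (w - z) *: S w (S z x)) /\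
  (forall z, D z -> exists C, forall x, nrm (S z x) <= C * nrm x).

Section PseudoResolvent.
Context {R : realType} {V : normedModType R[i]}.
Variables (D : set R[i]^o) (S : R[i]^o -> V -> V).
Hypotheses (oD : open D) (rS : pseudo_resolvent D S).

(** By the resolvent identity, the difference quotient of the orbit of x at z is the orbit of - S z
    x. Every order of smoothness thus reduces to local boundedness of orbits. *)
Lemma smooth_pseudo_resolvent n z x : D z -> smooth n (S^~ x) z.
Proof.
have [rid rbd] := rS.
move=> Dz; have nD : \forall w \near z, D w by exact: open_nbhs_nbhs.
elim: n x => [x|n IH x].
  have [C hC] := rbd z Dz.
  have C1 : 0 < `|C| + 1 by rewrite ltr_wpDl.
  (* Within this radius, S w x = S z x + (z - w) S z (S w x) has a last term of norm at most |S w x|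
     / 2, whence |S w x| <= 2 |S z x|. *)
  have e0 : 0 < (2 * (`|C| + 1))^-1 by rewrite invr_gt0 mulr_gt0.
  exists (2 * nrm (S z x)); apply: filterS2 nD (near_nrmB_lt z _ e0) => w Dw hw.
  have h1 := nrmD (S z x) ((z - w) *: S z (S w x)).
  have h2 : nrm ((z - w) *: S z (S w x)) <= 2^-1 * nrm (S w x).
    rewrite nrmZ nrmBC.
    apply: (@le_trans _ _ ((2 * (`|C| + 1))^-1 * ((`|C| + 1) * nrm (S w x)))).
      apply: ler_pM; rewrite ?nrm_ge0 ?(ltW hw)//.
      apply: le_trans (hC _) _; rewrite ler_wpM2r ?nrm_ge0//.
      by apply: le_trans (ler_norm _) _; rewrite lerDl.
    by rewrite invfM -mulrA mulKf ?gt_eqF.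
  have /eqP := rid w z x Dw Dz; rewrite eq_sym subr_eq => /eqP e.
  by rewrite -e in h1; lra.
exists (fun w => (-1 : R[i]^o) *: S w (S z x)).
  by apply: smoothZ; [exact: smooth_cst|exact: IH].
apply: filterS nD => w Dw.
by rewrite (rid z w x Dz Dw) scaleN1r scalerN.
Qed.

End PseudoResolvent.

(** * Estimates near an isolated singularity *)

Section PuncturedDisc.
Context {R : realType} {V : normedModType R[i]}.
Implicit Types (z w : R[i]^o).

Definition punctured_disc (s : R) : set R[i]^o := [set z | 0 < nrm z < s].

Lemma open_punctured_disc s : open (punctured_disc s).
Proof.
have -> : punctured_disc s = (nrm : R[i]^o -> R) @^-1` `]0, s[%classic.
  by apply/seteqP; split=> z /=; rewrite in_itv.
apply: open_comp; last exact: itv_open.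
by move=> z _; exact: nrm_continuous.
Qed.

(** Multiplication by w^-1 is the resolvent of the zero operator on the scalars, so it satisfies the
    resolvent identity. *)
Lemma smooth_inv n z : z != 0 -> smooth n (fun w => w^-1 : R[i]^o) z.
Proof.
move=> z0.
have := @smooth_pseudo_resolvent R R[i]^o (punctured_disc (nrm z + 1))
  (fun w x => w^-1 *: x) (open_punctured_disc _) _ n z 1.
have E : (fun w : R[i]^o => w^-1 *: (1 : R[i]^o)) = (fun w => w^-1).
  by apply/funext => w; rewrite -[LHS]/(w^-1 * 1) mulr1.
rewrite E; apply; last by rewrite /punctured_disc /= nrm_gt0 z0 ltrDl ltr01.
split=> [a b x /andP[a0 _] /andP[b0 _]|a _].
  move: a0 b0; rewrite !nrm_gt0 => a0 b0.
  by rewrite !scalerA -scalerBl; congr (_ *: _); field; rewrite a0 b0.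
by exists (nrm (a^-1)) => x; rewrite nrmZ.
Qed.

Variables (S : R[i]^o -> V -> V) (M s t : R).
Hypotheses (s0 : 0 < s) (st : s < t) (M0 : 0 <= M).
Hypothesis rS : pseudo_resolvent (punctured_disc t) S.
Hypothesis bS : forall z x, punctured_disc t z ->
  `|complex.Re z| * nrm (S z x) <= M * nrm x.

(** Since s < t, smoothness also holds on the circle |z| = s, which later serves as outer
    boundary. *)
Let smooth_orbit n z x : 0 < nrm z <= s -> smooth n (S^~ x) z.
Proof.
case/andP => z0 zs; apply: (smooth_pseudo_resolvent _ _ (open_punctured_disc t) rS).
by rewrite /punctured_disc /= z0 (le_lt_trans zs).
Qed.

(* The factors [w^2 + r^2], [w^2 + s^2] absorb [1/|Re w|] on the two boundary
   circles [|w| = r], [|w| = s] of the annulus. *)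
Lemma pole_order_le1 z x : 0 < nrm z <= s / 2 ->
  nrm z * nrm (S z x) <= 4 * M * nrm x.
Proof.
move=> /andP[z0 zs].
pose r := nrm z / 2.
have r0 : 0 < r by rewrite divr_gt0.
pose q (a : R) (w : R[i]^o) : R[i]^o := w *: w + (a ^+ 2)%:C.
have qE a w : q a w = w ^+ 2 + (a ^+ 2)%:C by rewrite /q -[w *: w]/(w * w).
pose f w := q r w *: (q s w *: (w^-1 *: S w x)).
have sq n a w : smooth n (q a) w.
  apply: smoothD; last exact: smooth_cst.
  by apply: smoothZ; exact: smooth_id.
have sf n w : r <= nrm w <= s -> smooth n f w.
  move=> /andP[w1 w2].
  have w0 : 0 < nrm w := lt_le_trans r0 w1.
  do 2 (apply: smoothZ; first exact: sq).
  apply: smoothZ; first by apply: smooth_inv; rewrite -nrm_gt0.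
  by apply: smooth_orbit; rewrite w0.
have fE w : nrm (f w) =
    nrm (w ^+ 2 + (r ^+ 2)%:C) * (nrm (w ^+ 2 + (s ^+ 2)%:C) *
      ((nrm w)^-1 * nrm (S w x))).
  by rewrite !nrmZ !qE; congr (_ * (_ * (_ * _))); exact: nrmV.
(* Here [a] is the radius of the circle carrying w and [b] that of the other one, so the estimate
   serves both boundary circles. *)
have bd a b w : 0 < a -> a <= s -> nrm w = a ->
    nrm (w ^+ 2 + (a ^+ 2)%:C) * (nrm (w ^+ 2 + (b ^+ 2)%:C) *
      ((nrm w)^-1 * nrm (S w x))) <= 2 * (a ^+ 2 + b ^+ 2) * (M * nrm x).
  move=> a0 as_ wa.
  rewrite (nrm_sqrD_circle w a wa) wa.
  have -> : 2 * a * `|complex.Re w| * (nrm (w ^+ 2 + (b ^+ 2)%:C) *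
      (a^-1 * nrm (S w x))) = 2 * nrm (w ^+ 2 + (b ^+ 2)%:C) *
      (`|complex.Re w| * nrm (S w x)) by field; rewrite gt_eqF.
  apply: ler_pM.
  - by rewrite mulr_ge0// nrm_ge0.
  - by rewrite mulr_ge0// nrm_ge0.
  - by rewrite ler_pM2l// -[in leRHS]wa nrm_sqrD_le.
  - by apply: bS; rewrite /punctured_disc /= wa a0 (le_lt_trans as_).
have hz : r <= nrm z <= s by rewrite /r; apply/andP; split; lra.
have rs : r <= s by rewrite /r; lra.
have := annulus_max (fun w => nrm (f w)) r s
  (2 * (r ^+ 2 + s ^+ 2) * (M * nrm x)) _ _ _ z hz.
rewrite fE => main.
have {main} : nrm (z ^+ 2 + (r ^+ 2)%:C) *
     (nrm (z ^+ 2 + (s ^+ 2)%:C) * ((nrm z)^-1 * nrm (S z x))) <=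
     2 * (r ^+ 2 + s ^+ 2) * (M * nrm x).
  apply: main => w.
  - move=> hw; apply: continuous_comp; last exact: nrm_continuous.
    by apply: smooth_continuous; exact: sf.
  - by move=> /andP[w1 w2]; apply: smooth_submean; apply: sf; rewrite !ltW.
  - case=> hw; rewrite fE; first exact: bd.
    by rewrite mulrCA [r ^+ 2 + _]addrC; exact: bd.
set N := nrm (S z x); set X := nrm x.
have N0 : 0 <= N := nrm_ge0 _.
(* Since r = |z| / 2 and |z| <= s / 2, neither factor is small at z: they are at least 3/4 |z|^2 and
   3/4 s^2. *)
have h1 : 3 / 4 * nrm z ^+ 2 <= nrm (z ^+ 2 + (r ^+ 2)%:C).
  apply: le_trans (nrm_sqrD_ge _ _); apply: le_trans (ler_norm _).
  by rewrite /r; lra.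
have h2 : 3 / 4 * s ^+ 2 <= nrm (z ^+ 2 + (s ^+ 2)%:C).
  apply: le_trans (nrm_sqrD_ge _ _); rewrite distrC; apply: le_trans (ler_norm _).
  have : nrm z ^+ 2 <= (s / 2) ^+ 2 by rewrite lerXn2r// nnegrE ltW// divr_gt0.
  lra.
have h3 : 0 <= (nrm z)^-1 * N by rewrite mulr_ge0// invr_ge0 ltW.
have h4 := ler_pM _ _ h1 (ler_wpM2r h3 h2).
have {h4} h4 : 9 / 16 * s ^+ 2 * (nrm z * N) <= nrm (z ^+ 2 + (r ^+ 2)%:C) *
     (nrm (z ^+ 2 + (s ^+ 2)%:C) * ((nrm z)^-1 * N)).
  apply: le_trans (h4 _ _).
  - by rewrite le_eqVlt; apply/orP; left; apply/eqP; field; rewrite gt_eqF.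
  - by rewrite mulr_ge0 ?sqr_ge0 ?divr_ge0.
  - by rewrite mulr_ge0// mulr_ge0 ?sqr_ge0 ?divr_ge0.
move/(le_trans h4) => h5.
(* Here r <= s / 4. The resulting constant is (17/8) / (9/16) = 34/9, which is below 4. *)
have h6 : 2 * (r ^+ 2 + s ^+ 2) * (M * X) <= 17 / 8 * s ^+ 2 * (M * X).
  rewrite ler_wpM2r// ?mulr_ge0 ?nrm_ge0//.
  have : r ^+ 2 <= (s / 4) ^+ 2.
    by rewrite lerXn2r ?nnegrE ?divr_ge0 ?(ltW r0) ?(ltW s0)//; rewrite /r; lra.
  lra.
have s2 : 0 < s ^+ 2 by rewrite exprn_gt0.
have MX : 0 <= s ^+ 2 * (M * X).
  by apply: mulr_ge0; [exact: ltW|apply: mulr_ge0 => //; exact: nrm_ge0].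
rewrite -(ler_pM2l s2).
lra.
Qed.

(* Removable singularity: [ln |w|] tends to [-oo] at the puncture, so that
   adding [d * ln |w|] makes the inner circle harmless. *)
Lemma removable_bound y K z :
  (forall w, 0 < nrm w <= s / 2 -> nrm (S w y) <= K) ->
  0 < nrm z <= s / 2 -> nrm (S z y) <= 8 * M / s * nrm y.
Proof.
move=> hK hz; have /andP[z0 zs] := hz.
have a0 : 0 < s / 2 by rewrite divr_gt0.
pose B := 8 * M / s * nrm y.
have B0 : 0 <= B.
  by rewrite mulr_ge0 ?nrm_ge0// divr_ge0 ?(ltW s0)// mulr_ge0.
have l0 : 0 <= ln (s / 2) - ln (nrm z) by rewrite subr_ge0 ler_ln ?posrE.
have key d : 0 < d -> nrm (S z y) + d * ln (nrm z) <= B + d * ln (s / 2).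
  move=> d0.
  (* The second entry makes K + d ln r <= d ln (s / 2), so [K] disappears from the bound; the first
     keeps z in the annulus. *)
  pose r := Num.min (nrm z) (s / 2 * expR (- (K / d))).
  have r0 : 0 < r by rewrite lt_min z0 mulr_gt0 ?expR_gt0.
  have rz : r <= nrm z by rewrite ge_min lexx.
  have lr : d * ln r <= d * ln (s / 2) - K.
    have -> : d * ln (s / 2) - K = d * (ln (s / 2) - K / d).
      by field; rewrite gt_eqF.
    rewrite ler_pM2l// -[X in _ <= _ + X]expRK -lnM ?posrE ?expR_gt0//.
    by rewrite ler_ln ?posrE ?mulr_gt0 ?expR_gt0// ge_min lexx orbT.
  apply: (annulus_max (fun w => nrm (S w y) + d * ln (nrm w)) r (s / 2)) => [w|w|w|].
  - move=> /andP[w1 w2]; have w0 := lt_le_trans r0 w1.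
    have ws : 0 < nrm w <= s by rewrite w0; lra.
    apply: continuousD.
      apply: continuous_comp; last exact: nrm_continuous.
      by apply: smooth_continuous; exact: smooth_orbit.
    apply: continuousM; first exact: cst_continuous.
    apply: continuous_comp; first exact: nrm_continuous.
    exact: continuous_ln.
  - move=> /andP[w1 w2]; have w0 := lt_trans r0 w1.
    apply: submeanD.
      by apply: smooth_submean; apply: smooth_orbit; rewrite w0; lra.
    by apply: submean_ln; rewrite ?ltW// -nrm_gt0.
  - case=> hw.
      have wr : 0 < nrm w <= s / 2 by rewrite hw r0 (le_trans rz).
      rewrite hw; have := hK w wr; lra.
    rewrite hw lerD2r.
    (* On the outer circle |w| = s / 2, the simple pole bound 4 M |y| divided by s / 2 gives 8 M |y|
       / s. *)
    have := pole_order_le1 w y; rewrite hw lexx a0 => /(_ erefl) h.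
    rewrite -(ler_pM2l a0) (le_trans h)// /B le_eqVlt; apply/orP; left.
    by apply/eqP; field; rewrite gt_eqF.
  - by rewrite rz.
apply/ler_addgt0Pr => e e0.
pose l := ln (s / 2) - ln (nrm z).
have l1 : 0 < l + 1 by rewrite ltr_wpDl.
(* Now d tends to 0: this value makes the logarithmic correction d l at most e. *)
have d0 : 0 < e / (l + 1) by rewrite divr_gt0.
have := key _ d0.
have : e / (l + 1) * l <= e.
  by rewrite mulrAC ler_pdivrMr// ler_pM2l// lerDl.
rewrite -/B /l; lra.
Qed.

End PuncturedDisc.

(** * Algebra of the resolvent of an unbounded operator *)

Section Resolvent.
Context {R : realType} {X : normedModType R[i]} {A : linear_op X}.
Implicit Types (x y : X) (l m : R[i]).

Lemma lop_fun0 : A 0 = 0.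
Proof.
have := lop_linear (-1) (lop_dom0 A) (lop_dom0 A).
by rewrite scaler0 addr0 scaleN1r addNr.
Qed.

Lemma lop_domZ a x : lop_dom A x -> lop_dom A (a *: x).
Proof.
by move=> hx; rewrite -[_ *: _]addr0; apply: lop_domP; last exact: lop_dom0.
Qed.

Lemma lop_funZ a x : lop_dom A x -> A (a *: x) = a *: A x.
Proof.
move=> hx; have := lop_linear a hx (lop_dom0 A).
by rewrite lop_fun0 !addr0.
Qed.

Lemma shift_opP l a x y : lop_dom A x -> lop_dom A y ->
  shift_op A l (a *: x + y) = a *: shift_op A l x + shift_op A l y.
Proof.
move=> hx hy; rewrite /shift_op lop_linear// scalerDr scalerBr !scalerA.
by rewrite (mulrC l) opprD addrACA.
Qed.

Section ResolventAt.
Variable (l : R[i]).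
Hypothesis bl : set_bij (lop_dom A) setT (shift_op A l).

Lemma resolventP y : lop_dom A (resolvent A l y) /\
  shift_op A l (resolvent A l y) = y.
Proof.
rewrite /resolvent; case: xgetP => [x -> //|h].
have [_ _ /(_ y I)[x hx e]] := bl.
by have := h x; case.
Qed.

Lemma resolvent_shift x : lop_dom A x -> resolvent A l (shift_op A l x) = x.
Proof.
move=> hx; have [h e] := resolventP (shift_op A l x).
by have [_ + _] := bl; apply => //; rewrite inE.
Qed.

Lemma resolvent_linear a x y :
  resolvent A l (a *: x + y) = a *: resolvent A l x + resolvent A l y.
Proof.
have [hx ex] := resolventP x; have [hy ey] := resolventP y.
rewrite -{1}ex -{1}ey -shift_opP// resolvent_shift//.
exact: lop_domP.
Qed.

Lemma resolventZ a x : resolvent A l (a *: x) = a *: resolvent A l x.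
Proof.
have [hx ex] := resolventP x.
have e : shift_op A l (a *: resolvent A l x) = a *: x.
  by rewrite -{2}ex /shift_op lop_funZ// scalerBr !scalerA mulrC.
by rewrite -e resolvent_shift//; exact: lop_domZ.
Qed.

Lemma op_norm_resolvent_le (c : R) x :
  (op_norm (resolvent A l) <= c%:E)%E -> nrm (resolvent A l x) <= c * nrm x.
Proof.
move=> h; have [->|x0] := eqVneq x 0.
  by have := resolventZ 0 0; rewrite !scale0r => ->; rewrite !nrm0 mulr0.
have n0 : 0 < nrm x by rewrite nrm_gt0.
pose u := (nrm x)^-1%:C *: x.
have nu : nrm u = 1.
  by rewrite nrmZ nrm_real gtr0_norm ?invr_gt0// mulVf ?gt_eqF.
have xu : x = (nrm x)%:C *: u.
  by rewrite scalerA -rmorphM divff ?gt_eqF// scale1r.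
have : ((nrm (resolvent A l u))%:E <= c%:E)%E.
  apply: le_trans h; apply: ereal_sup_ubound; exists u => //=.
  by rewrite nrmE nu.
rewrite lee_fin => h'.
rewrite {1}xu resolventZ nrmZ nrm_real gtr0_norm// mulrC.
by rewrite ler_wpM2r// ltW.
Qed.

End ResolventAt.

Lemma resolvent_set_bij l : resolvent_set A l ->
  set_bij (lop_dom A) setT (shift_op A l).
Proof. by case. Qed.

Lemma resolvent_bounded l : resolvent_set A l ->
  exists C, forall x, nrm (resolvent A l x) <= C * nrm x.
Proof.
move=> [bl]; case E: (op_norm (resolvent A l)) => [r| |] // _.
  by exists r => x; apply: op_norm_resolvent_le; rewrite // E.
(* The value -oo is excluded because 0 lies in the unit ball. *)
exfalso; have : ((nrm (resolvent A l 0))%:E <= op_norm (resolvent A l))%E.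
  by apply: ereal_sup_ubound; exists 0 => //=; rewrite normr0.
by rewrite E.
Qed.

Lemma resolvent_identity l m x : resolvent_set A l -> resolvent_set A m ->
  resolvent A m x =
  resolvent A l x - (m - l) *: resolvent A m (resolvent A l x).
Proof.
move=> /resolvent_set_bij hl /resolvent_set_bij hm.
have [hu eu] := resolventP _ hl x.
set u := resolvent A l x in hu eu *.
have -> : x = - (m - l) *: u + shift_op A m u.
  by rewrite -eu /shift_op opprB scalerBl [RHS]addrA subrK.
by rewrite resolvent_linear// resolvent_shift// scaleNr addrC.
Qed.

Lemma lop_resolvent l x : resolvent_set A l ->
  A (resolvent A l x) = l *: resolvent A l x - x.
Proof.
move=> /resolvent_set_bij hl; have [_ e] := resolventP _ hl x.
by rewrite -{3}e /shift_op opprB addrC subrK.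
Qed.

(** Comes from A - c = l - (c + l - A). It turns a bound on l R(c + l) into one on R(c + l) over the
    range of A - c. *)
Lemma resolvent_lop l c x : resolvent_set A (c + l) -> lop_dom A x ->
  resolvent A (c + l) (A x - c *: x) = l *: resolvent A (c + l) x - x.
Proof.
move=> /resolvent_set_bij hl hx.
have -> : A x - c *: x = l *: x + (-1) *: shift_op A (c + l) x.
  rewrite scaleN1r /shift_op opprB scalerDl opprD.
  by rewrite [A x + (_ - _)]addrA addrCA subrr addr0.
by rewrite resolvent_linear// resolventZ// resolvent_shift// scaleN1r.
Qed.

Lemma resolvent_pseudo_resolvent (c : R[i]) (s : R) :
  (forall z, punctured_disc s z -> resolvent_set A (c + z)) ->
  pseudo_resolvent (punctured_disc s) (fun z => resolvent A (c + z)).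
Proof.
move=> h; split=> [z w x hz hw|z hz]; last by apply: resolvent_bounded; exact: h.
have <- : c + w - (c + z) = w - z by rewrite opprD addrACA subrr add0r.
by apply: resolvent_identity; exact: h.
Qed.

End Resolvent.

(** * Limits at the puncture, by completeness and closedness *)

Lemma lipschitz_right_limit {R : realType} {V : completeNormedModType R[i]}
    (f : R -> V) (s C : R) : 0 < s ->
  (forall t u, 0 < t <= s -> 0 < u <= s -> nrm (f t - f u) <= C * `|t - u|) ->
  exists2 l : V, f t @[t --> 0^'+] --> l &
    forall t, 0 < t <= s -> nrm (f t - l) <= C * t.
Proof.
move=> s0 lip.
have C0 : 0 <= C.
  have s2 : 0 < s / 2 by rewrite divr_gt0.
  have := lip s (s / 2); rewrite s0 s2 lexx ler_pdivrMr// ler_pMr// ler1n.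
  move=> /(_ erefl erefl) /(le_trans (nrm_ge0 _)).
  by rewrite pmulr_lge0// normr_gt0 subr_eq0; lra.
have fcvg : cvg (f t @[t --> 0^'+]).
  apply: cauchy_cvg; apply: cauchy_exP => e e0.
  have [e1 e2] : (0 < complex.Re e) /\ e = (complex.Re e)%:C.
    by move: e0; rewrite ltcE; case: (e) => a b /= /andP[/eqP -> ->].
  have C1 : 0 < C + 1 by rewrite ltr_wpDl.
  (* All f t with 0 < t < u lie in the ball of radius e around f u, which is the Cauchy
     criterion. *)
  pose u := Num.min s (complex.Re e / (C + 1)).
  have u0 : 0 < u by rewrite lt_min s0 divr_gt0.
  have us : u <= s by rewrite ge_min lexx.
  have ue : u * (C + 1) <= complex.Re e.
    by rewrite -ler_pdivlMr// ge_min lexx orbT.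
  exists (f u).
  change (\forall t \near 0^'+, ball (f u) e (f t)); near=> t.
  have t0 : 0 < t by near: t; exact: nbhs_right_gt.
  have tu : t < u by near: t; exact: nbhs_right_lt.
  rewrite -ball_normE /= nrmE e2 ltcR.
  apply: le_lt_trans (lip u t _ _) _; first by rewrite u0.
    by rewrite t0 (le_trans (ltW tu)).
  rewrite gtr0_norm ?subr_gt0//; apply: lt_le_trans ue.
  by rewrite mulrC; nra.
pose l := lim (f t @[t --> 0^'+]).
exists l; first exact: fcvg.
move=> t /andP[t0 ts].
(* Lets u tend to 0 in |f t - f u| <= C (t - u) <= C t. *)
apply: (@closed_cvg _ _ (0^'+ : set_system R) _ (fun u => f t - f u)
  [set x | nrm x <= C * t]).
- have -> : [set x : V | nrm x <= C * t] = nrm @^-1` `]-oo, C * t]%classic.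
    by apply/seteqP; split => x /=; rewrite in_itv.
  apply: preimage_closed; first by move=> x _; exact: nrm_continuous.
  exact: lray_closed.
- near=> u.
  have u0 : 0 < u by near: u; exact: nbhs_right_gt.
  have ut : u < t by near: u; exact: nbhs_right_lt.
  rewrite /=; apply: le_trans (lip t u _ _) _; first by rewrite t0.
    by rewrite u0 (le_trans (ltW ut)).
  by rewrite gtr0_norm ?subr_gt0// ler_wpM2l// gerBl ltW.
- by apply: cvgB; [exact: cvg_cst|exact: fcvg].
Unshelve. all: by end_near.
Qed.

Lemma closed_op_cvg {R : realType} {X : normedModType R[i]} {A : linear_op X}
    (T : Type) (F : set_system T) {FF : ProperFilter F} (f : T -> X) (x y : X) :
  closed_op A -> (\forall t \near F, lop_dom A (f t)) ->
  f t @[t --> F] --> x -> A (f t) @[t --> F] --> y ->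
  lop_dom A x /\ A x = y.
Proof.
move=> cA df fx fy.
suff [] : [set z : X * X | lop_dom A z.1 /\ z.2 = A z.1] (x, y).
  by move=> /= ? ->.
apply: (@closed_cvg _ _ F _ (fun t => (f t, A (f t))) _ cA); first last.
  exact: cvg_pair.
by apply: filterS df => t.
Qed.

(** * Punctures of the resolvent set on the imaginary axis *)

Section IsolatedSpectrum.
Context {R : realType} {X : completeNormedModType R[i]} {A : linear_op X}.
Variable (M : R).
Hypotheses (M0 : 0 < M) (cA : closed_op A).
Hypothesis hM : forall l : R[i], complex.Re l != 0 ->
  (op_norm (resolvent A l) <= (M / `|complex.Re l|)%:E)%E.

(** Translation by i xi leaves real parts unchanged. The product form includes Re z = 0, where the
    left side vanishes. *)
Let bound (xi : R) (s : R) :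
  (forall z, punctured_disc s z -> resolvent_set A ((0 +i* xi) + z)) ->
  forall z x, punctured_disc s z ->
  `|complex.Re z| * nrm (resolvent A ((0 +i* xi) + z) x) <= M * nrm x.
Proof.
move=> h z x hz; have [->|z0] := eqVneq (complex.Re z) 0.
  by rewrite normr0 mul0r mulr_ge0 ?nrm_ge0// ltW.
have rz : complex.Re (0 +i* xi + z) = complex.Re z.
  by case: (z) => a b /=; rewrite add0r.
have := hM (0 +i* xi + z); rewrite rz => /(_ z0).
move/(op_norm_resolvent_le _ (resolvent_set_bij _ (h _ hz)) _ x).
by rewrite mulrAC ler_pdivlMr ?normr_gt0// mulrC.
Qed.

Section Estimates.
Variables (xi s t : R).
Hypotheses (s0 : 0 < s) (st : s < t).
Let c : R[i] := 0 +i* xi.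
Hypothesis h : forall z, punctured_disc t z -> resolvent_set A (c + z).
Let S z := resolvent A (c + z).
Let rho z : 0 < nrm z <= s / 2 -> resolvent_set A (c + z).
Proof.
move=> /andP[z0 zs]; apply: h; rewrite /punctured_disc /= z0.
have s2 : s / 2 <= s by rewrite ler_pdivrMr// ler_pMr// ler1n.
exact: le_lt_trans (le_trans zs s2) st.
Qed.

Lemma resolvent_simple_pole z x : 0 < nrm z <= s / 2 ->
  nrm (z *: S z x) <= 4 * M * nrm x.
Proof.
move=> hz; rewrite nrmZ.
have := @pole_order_le1 R X S M s t s0 st (ltW M0)
  (resolvent_pseudo_resolvent c t h) (bound xi t h) z x hz.
exact.
Qed.

(** On the range of A - c, [resolvent_lop] and the simple pole estimate give some bound depending on
    y; [removable_bound] trades it for one proportional to |(A - c) y| that decays as s grows. *)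
Lemma resolvent_range_bound y z : lop_dom A y -> 0 < nrm z <= s / 2 ->
  nrm (S z (A y - c *: y)) <= 8 * M / s * nrm (A y - c *: y).
Proof.
move=> hy hz.
apply: (@removable_bound R X S M s t s0 st (ltW M0)
  (resolvent_pseudo_resolvent c t h) (bound xi t h) _
  (4 * M * nrm y + nrm y) z) => // w hw.
rewrite /S resolvent_lop//; last exact: rho.
apply: le_trans (nrmB _ _) _; rewrite lerD2r.
exact: resolvent_simple_pole.
Qed.

End Estimates.

Section Puncture.
Variables (xi s t : R).
Hypotheses (s0 : 0 < s) (st : s < t).
Let c : R[i] := 0 +i* xi.
Hypothesis h : forall z, punctured_disc t z -> resolvent_set A (c + z).
Let S (u : R) := resolvent A (c + u%:C).
Let nrmC (u : R) : 0 < u -> nrm (u%:C : R[i]^o) = u.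
Proof. by move=> u0; have := nrm_real u; rewrite gtr0_norm. Qed.
Let disc (u : R) : 0 < u <= s / 2 -> 0 < nrm (u%:C : R[i]^o) <= s / 2.
Proof. by case/andP => u0 us; rewrite nrmC// u0. Qed.
Let rho (u : R) : 0 < u <= s / 2 -> resolvent_set A (c + u%:C).
Proof.
case/andP => u0 us; apply: h; rewrite /punctured_disc /= nrmC// u0.
have s2 : s / 2 <= s by rewrite ler_pdivrMr// ler_pMr// ler1n.
exact: le_lt_trans (le_trans us s2) st.
Qed.
Let s20 : 0 < s / 2. Proof. by rewrite divr_gt0. Qed.

(** Product of the range bound 8 M / s and of the bound 4 M + 1 for (A - c) R(c + v) = v R(c + v) -
    1. *)
Let L := 8 * M / s * (4 * M + 1).
Let L0 : 0 <= L.
Proof. by rewrite mulr_ge0 ?divr_ge0 ?addr_ge0 ?mulr_ge0 ?ltW. Qed.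

Let resolvent_diff (u v : R) x : 0 < u <= s / 2 -> 0 < v <= s / 2 ->
  S u x = S v x - (u - v)%:C *: S u (S v x).
Proof.
move=> hu hv; have -> : (u - v)%:C = c + u%:C - (c + v%:C).
  by rewrite opprD addrACA subrr add0r rmorphB.
by apply: resolvent_identity; exact: rho.
Qed.

Let lopS x (u : R) : 0 < u <= s / 2 ->
  lop_dom A (S u x) /\ A (S u x) = c *: S u x + u%:C *: S u x - x.
Proof.
move=> hu; split.
  by have [] := resolventP _ (resolvent_set_bij _ (rho u hu)) x.
by rewrite /S lop_resolvent; [rewrite scalerDl|exact: rho].
Qed.

(* [zR(z) - wR(w) = (w - z) R(z) A R(w)], and [R(z)A] is bounded. *)
Let scaled_lipschitz x (u v : R) : 0 < u <= s / 2 -> 0 < v <= s / 2 ->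
  nrm (u%:C *: S u x - v%:C *: S v x) <= L * nrm x * `|u - v|.
Proof.
move=> hu hv.
have [dy Ay] := lopS x v hv.
have {}Ay : A (S v x) - c *: S v x = v%:C *: S v x - x.
  by rewrite Ay addrAC [c *: _ + _]addrC addrK.
have -> : u%:C *: S u x - v%:C *: S v x =
    - ((u - v)%:C *: S u (A (S v x) - c *: S v x)).
  rewrite /S (resolvent_lop _ _ _ (rho u hu) dy).
  rewrite -/(S u _) -/(S v x) (resolvent_diff u v x)//.
  rewrite !scalerBr !scalerA [u%:C * _]mulrC opprB addrAC; congr (_ - _).
  by rewrite -scalerBl rmorphB.
rewrite nrmN nrmZ nrm_real mulrC ler_wpM2r//.
apply: le_trans (resolvent_range_bound xi s t s0 st h _ _ dy (disc u hu)) _.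
rewrite Ay /L -[leRHS]mulrA ler_wpM2l//; first by rewrite divr_ge0 ?mulr_ge0 ?ltW.
apply: le_trans (nrmB _ _) _; rewrite mulrDl mul1r lerD2r.
exact: (resolvent_simple_pole xi s t s0 st h _ _ (disc v hv)).
Qed.

Let near_disc : \forall u \near 0^'+, 0 < u <= s / 2.
Proof.
near=> u; apply/andP; split; first by near: u; exact: nbhs_right_gt.
by near: u; exact: nbhs_right_le.
Unshelve. all: by end_near. Qed.

Let real_cvg0 : (u%:C : R[i]^o) @[u --> 0^'+] --> (0 : R[i]^o).
Proof.
apply: cvg_nrmP => e e0; near=> u.
have u0 : 0 < u by near: u; exact: nbhs_right_gt.
by rewrite subr0 nrmC//; near: u; exact: nbhs_right_le.
Unshelve. all: by end_near. Qed.

(** A maps u S(u) x to c (u S(u) x) + u (u S(u) x - x), which tends to c l; closedness of A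
    concludes. *)
Let residue_ker x l : (u%:C *: S u x) @[u --> 0^'+] --> l ->
  lop_dom A l /\ A l = c *: l.
Proof.
move=> hl; apply: (@closed_op_cvg R X A R 0^'+ _ (fun u => u%:C *: S u x) l
  (c *: l) cA _ hl).
  apply: filterS near_disc => u hu; apply: lop_domZ.
  exact: (lopS x u hu).1.
have : c *: (u%:C *: S u x) + u%:C *: (u%:C *: S u x - x) @[u --> 0^'+] -->
    c *: l + (0 : R[i]^o) *: (l - x).
  apply: cvgD; first exact: cvgZr.
  apply: cvgZ; first exact: real_cvg0.
  by apply: cvgB; [exact: hl|exact: cvg_cst].
rewrite scale0r addr0; apply: cvg_trans; apply: near_eq_cvg.
apply: filterS near_disc => u hu.
have [du Au] := lopS x u hu.
rewrite lop_funZ// Au -addrA [RHS]scalerDr; congr (_ + _).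
by rewrite !scalerA mulrC.
Qed.

(** Uniformly bounded resolvents make u -> S(u) x Lipschitz by the resolvent identity. Its limit at
    0 solves (c - A) l = x by closedness. *)
Let bounded_resolvent_set C : 0 <= C ->
  (forall x u, 0 < u <= s / 2 -> nrm (S u x) <= C * nrm x) -> resolvent_set A c.
Proof.
move=> C0 hC.
(* The constant adds |S(s/2) x| <= C |x| to the distance from S(s/2) x to its limit, at most C^2
   (s/2) |x|. *)
have sol x : exists l, [/\ lop_dom A l, shift_op A c l = x &
    nrm l <= (C + C * C * (s / 2)) * nrm x].
  have [|l fl ll] :=
    lipschitz_right_limit (S^~ x) (s / 2) (C * (C * nrm x)) s20.
    move=> u v hu hv; rewrite (resolvent_diff u v)//.
    rewrite addrAC subrr sub0r nrmN nrmZ nrm_real mulrC ler_wpM2r//.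
    apply: le_trans (hC _ _ hu) _; rewrite ler_wpM2l//; exact: hC.
  have [dl Al] : lop_dom A l /\ A l = c *: l - x.
    apply: (@closed_op_cvg R X A R 0^'+ _ (S^~ x) l (c *: l - x) cA _ fl).
      apply: filterS near_disc => u hu.
      exact: (lopS x u hu).1.
    have : c *: S u x + u%:C *: S u x - x @[u --> 0^'+] -->
        c *: l + (0 : R[i]^o) *: l - x.
      apply: cvgB; last exact: cvg_cst.
      apply: cvgD; first exact: cvgZr.
      by apply: cvgZ; [exact: real_cvg0|exact: fl].
    rewrite scale0r addr0; apply: cvg_trans; apply: near_eq_cvg.
    apply: filterS near_disc => u hu.
    by rewrite (lopS x u hu).2.
  exists l; split => //; first by rewrite /shift_op Al subKr.
  have hs : 0 < s / 2 <= s / 2 by rewrite s20 lexx.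
  rewrite -[l](subrK (S (s / 2) x)) (le_trans (nrmD _ _))//.
  rewrite nrmBC mulrDl addrC lerD ?hC// (le_trans (ll _ hs))//.
  have -> : C * (C * nrm x) * (s / 2) = C * C * (s / 2) * nrm x by ring.
  exact: lexx.
have bij : set_bij (lop_dom A) setT (shift_op A c).
  split=> // [x y|x _]; last by have [l [dl el _]] := sol x; exists l.
  rewrite !inE => dx dy exy.
  pose d := (-1) *: x + y.
  have dd : lop_dom A d by exact: lop_domP.
  have Ad : A d - c *: d = 0.
    apply/eqP; rewrite -oppr_eq0 opprB -/(shift_op A c d) shift_opP// exy.
    by rewrite scaleN1r addNr.
  (* A vector d of the kernel of A - c satisfies d = u S(u) d, so |d| <= u C |d|; taking u C <= 1/2
     forces d = 0. *)
  have dS u : 0 < u <= s / 2 -> d = u%:C *: S u d.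
    move=> hu; have := resolvent_lop _ _ _ (rho u hu) dd; rewrite Ad.
    have := resolventZ _ (resolvent_set_bij _ (rho u hu)) 0 0.
    by rewrite !scale0r => -> /esym/eqP; rewrite subr_eq0 => /eqP.
  have C1 : 0 < 2 * C + 1 by rewrite ltr_wpDl// mulr_ge0.
  pose u := Num.min (s / 2) (2 * C + 1)^-1.
  have u0 : 0 < u by rewrite lt_min s20 invr_gt0.
  have us : u <= s / 2 by rewrite ge_min lexx.
  have uC : u * (2 * C + 1) <= 1.
    by rewrite -ler_pdivlMr// div1r ge_min lexx orbT.
  have hu : 0 < u <= s / 2 by rewrite u0.
  have d_le : nrm d <= u * (C * nrm d).
    by rewrite {1}(dS u hu) nrmZ nrm_real gtr0_norm// ler_wpM2l ?hC// ltW.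
  have d0 : nrm d <= 0.
    have := ler_wpM2r (nrm_ge0 d) uC; have := mulr_ge0 (ltW u0) (nrm_ge0 d).
    lra.
  have : nrm d == 0 by rewrite eq_le d0 nrm_ge0.
  by rewrite nrm_eq0 /d scaleN1r addrC subr_eq0 => /eqP.
split=> //; apply: (@le_lt_trans _ _ (C + C * C * (s / 2))%:E); last exact: ltry.
apply: ge_ereal_sup => _ [x /= x1 <-]; rewrite lee_fin -/(nrm _).
have [l [dl el nl]] := sol x.
rewrite -{1}el resolvent_shift// (le_trans nl)//.
rewrite ler_piMr ?addr_ge0 ?mulr_ge0 ?(ltW s0)//.
by move: x1; rewrite nrmE -[1]/(1%:C) lecR.
Qed.

(** Without eigenvectors every limit of u S(u) x is 0, and the Lipschitz estimate becomes u |S(u) x|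
    <= L |x| u. Dividing by u bounds S(u), so c is in the resolvent set. *)
Lemma isolated_eigenvalue : ~ resolvent_set A c -> eigenvalue_op A c.
Proof.
move=> nc; apply: contrapT => ne; apply: nc.
apply: (bounded_resolvent_set L L0) => x u hu.
have [l fl ll] := lipschitz_right_limit (fun u => u%:C *: S u x) (s / 2)
  (L * nrm x) s20 (scaled_lipschitz x).
have [dl Al] := residue_ker x l fl.
have l0 : l = 0 by apply: contrapT => /eqP l0; apply: ne; exists l.
have := ll u hu; rewrite l0 subr0 nrmZ nrm_real.
by case/andP: hu => u0 _; rewrite gtr0_norm// mulrC ler_pM2r.
Qed.

End Puncture.

(** The radius s is arbitrary while the evaluation point stays at 1, so |R(1) A y| <= 8 M |A y| / s
    for all large s. Hence R(1) A y = 0, and A y = 0. *)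
Lemma zero_op_of_spectrum_sub0 :
  (forall z : R[i], z != 0 -> resolvent_set A z) -> is_zero_op A.
Proof.
move=> h.
have h1 : resolvent_set A (0 +i* 0 + 1).
  by rewrite add0r; apply: h; exact: oner_neq0.
have A0 y : lop_dom A y -> A y = 0.
  move=> dy; pose w := resolvent A (0 +i* 0 + 1) (A y - (0 +i* 0) *: y).
  have w0 : nrm w <= 0.
    apply/ler_addgt0Pr => e e0; rewrite add0r.
    pose B := 8 * M * nrm (A y - (0 +i* 0) *: y).
    have B0 : 0 <= B by rewrite !mulr_ge0 ?nrm_ge0 ?ltW.
    (* The summand B / e gives B / s <= e, and 2 puts the point 1 in the disc |z| <= s / 2. *)
    pose s := B / e + 2.
    have s2 : 2 <= s by rewrite lerDr divr_ge0// ltW.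
    have s0 : 0 < s by rewrite (lt_le_trans _ s2).
    have ss : s < s + 1 by rewrite ltrDl.
    have hs z : punctured_disc (s + 1) z -> resolvent_set A (0 +i* 0 + z).
      by case/andP => z0 _; rewrite add0r; apply: h; rewrite -nrm_gt0.
    have z1 : 0 < nrm (1 : R[i]^o) <= s / 2.
      have -> : nrm (1 : R[i]^o) = 1.
        by have := nrm_real (1 : R); rewrite normr1.
      by rewrite ltr01 ler_pdivlMr// mul1r.
    have := resolvent_range_bound 0 s (s + 1) s0 ss hs y 1 dy z1.
    move/le_trans; apply; rewrite mulrAC -/B ler_pdivrMr// /s mulrDr mulrC.
    by rewrite divfK ?gt_eqF// lerDl mulr_ge0// ltW.
  have {}w0 : w = 0 by apply/eqP; rewrite -nrm_eq0 eq_le w0 nrm_ge0.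
  have [_ e] := resolventP _ (resolvent_set_bij _ h1) (A y - (0 +i* 0) *: y).
  move: e; rewrite -/w w0 /shift_op scaler0 lop_fun0 subrr.
  by rewrite scale0r subr0.
(* As A vanishes on its domain, 1 - A is the identity there, and its surjectivity makes the domain
   the whole space. *)
have dT x : lop_dom A x.
  have [dw e] := resolventP _ (resolvent_set_bij _ h1) x.
  move: e; rewrite /shift_op (A0 _ dw) subr0 add0r scale1r => e.
  by rewrite add0r e in dw.
split; last by move=> x; exact: A0.
by apply/seteqP; split.
Qed.

End IsolatedSpectrum.

(** * From punctures to the spectrum *)

Theorem theorem2p18 (R : realType) (X : completeNormedModType R[i])
    (A : linear_op X) (hA : closed_op A)
    (ha : spectrum A `<=` [set l : R[i] | complex.Re l = 0])
    (hb : exists2 M : R, 0 < M &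
      forall l : R[i], complex.Re l != 0 ->
        (op_norm (resolvent A l) <= (M / `|complex.Re l|)%:E)%E) :
  [/\ forall xi : R, isolated (spectrum A) (0 +i* xi) ->
        eigenvalue_op A (0 +i* xi),
      (exists x : X, x != 0) -> spectrum A !=set0
    & spectrum A = [set 0] -> is_zero_op A].
Proof.
have [M M0 hM] := hb.
have resE l : ~ spectrum A l -> resolvent_set A l by move/contrapT.
split=> [xi|[x x0]|sp].
- rewrite /isolated inE => -[sxi [W nW WE]].
  have [d d0 dW] := (near_nrmP _ _ _).1 nW.
  have d2 : d / 2 < d by rewrite ltr_pdivrMr// ltr_pMr// ltr1n.
  apply: (isolated_eigenvalue M M0 hA hM xi (d / 2) d) => //.
    by rewrite divr_gt0.
  move=> z /andP[z0 zd]; apply: resE => sz.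
  have : (W `&` spectrum A) (0 +i* xi + z).
    by split=> //; apply: dW; rewrite addrC addKr.
  rewrite WE /= => /eqP; rewrite -subr_eq0 addrC addKr -nrm_eq0.
  by rewrite gt_eqF.
(* An empty spectrum gives A = 0 everywhere, while 0 in the resolvent set makes 0 - A injective; so
   x = 0. *)
- apply/set0P/negP => /eqP sp.
  have rA l : resolvent_set A l by apply: resE; rewrite sp.
  have [dT A0] := zero_op_of_spectrum_sub0 M M0 hM (fun z _ => rA z).
  have [_ + _] := resolvent_set_bij _ (rA 0).
  move=> /(_ x 0); rewrite !inE dT /shift_op !A0 !scale0r.
  by move=> /(_ I I erefl) e; rewrite e eqxx in x0.
- apply: (zero_op_of_spectrum_sub0 M M0 hM) => z z0; apply: resE.
  by rewrite sp => /= /eqP; exact/negP.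
Qed.
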